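(* Let $\Gamma$ be a finite dynamic game with ordinal preferences and perfect recall, and let $i\in I$. A strategy $s^*_i\in S_i$ is sequentially rational if and only if it is not conditionally B-dominated with respect to $S$.
   Context: A finite dynamic game with ordinal preferences and perfect recall $\Gamma$ consists of: a finite set of players $I$; a finite set $X$ of histories (finite sequences of action profiles, possibly with simultaneous moves), ordered by the prefix relation, with the empty history as root, and the set $Z\subseteq X$ of terminal histories (outcomes); for each player $i$ a partition $H_i$ of the non-terminal histories at which $i$ is active (has at least two available actions) into information sets, such that $i$'s available actions $A_i(h)$ are the same at all histories of $h$; perfect recall; and for each player $i$ a complete, transitive preference relation $\succsim_i$ on $Z$ (with asymmetric part $\succ_i$ and symmetric part $\sim_i$). A standard strategy of $i$ selects an action in $A_i(h)$ for each $h\in H_i$; two standard strategies are behaviorally equivalent if they allow the same information sets and prescribe the same actions there; a strategy of $i$ is an equivalence class of behaviorally equivalent standard strategies. $S_i$ is $i$'s (finite) set of strategies, $S=\prod_{j\in I}S_j$, $S_{-i}=\prod_{j\neq i}S_j$, and $\zeta:S\to Z$ maps a strategy profile to the terminal history it reaches. For $h\in H_i$, $S_i(h)$ and $S_{-i}(h)$ are the sets of strategies of $i$, resp. strategy profiles of the others, that reach $h$ (by perfect recall the profiles reaching $h$ are exactly $S_i(h)\times S_{-i}(h)$). $H_i(s_i):=\{h\in H_i: s_i\in S_i(h)\}$. A restriction is a nonempty set $R=\prod_{j\in I}R_j\subseteq S$. For $h\in H_i$: $R_i(h)=R_i\cap S_i(h)$, $R_{-i}(h)=R_{-i}\cap S_{-i}(h)$,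 $R^i(h)=R_i(h)\times R_{-i}(h)$. Dominance: for a set $P=P_i\times P_{-i}$ with $P_i\subseteq S_i$, $P_{-i}\subseteq S_{-i}$ ($P_{-i}$ need not be a product), $s_i\in P_i$ is weakly dominated relative to $P$ by $t_i\in P_i$ if $\zeta(t_i,s_{-i})\succsim_i\zeta(s_i,s_{-i})$ for all $s_{-i}\in P_{-i}$, with $\succ_i$ for at least one $s_{-i}\in P_{-i}$. $s_i\in P_i$ is B-dominated with respect to $P$ if for every nonempty $Q_{-i}\subseteq P_{-i}$, $s_i$ is weakly dominated relative to $P_i\times Q_{-i}$ by some strategy in $P_i$. Given a restriction $R$, $s_i\in R_i$ is conditionally B-dominated with respect to $R$ if there is $h\in H_i(s_i)$ with $R^i(h)\neq\emptyset$ such that $s_i$ is B-dominated with respect to $R^i(h)$. Utilities and beliefs: $\mathcal U_i$ is the set of functions $u_i:Z\to\mathbb R$ with $u_i(z)\ge u_i(z')\iff z\succsim_i z'$. Let $\mathcal H_i=\{S_{-i}(h):h\in H_i\}$. A conditional probability system (CPS) on $(S_{-i},\mathcal H_i)$ is a family $(\mu_i(\cdot\mid E))_{E\in\mathcal H_i}$ of probability measures on $S_{-i}$ with $\mu_i(E\mid E)=1$ and, whenever $A\subseteq E'\subseteq E$ with $E,E'\in\mathcal H_i$, $\mu_i(A\mid E)=\mu_i(A\mid E')\,\mu_i(E'\mid E)$. A strategy $s^*_i\in S_i$ is sequentially rational if there exist $u_i\in\mathcal U_i$ and a CPS $\mu_i$ such that for every $h\in H_i(s^*_i)$ and every $s_i\in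 S_i(h)$: $\sum_{s_{-i}\in S_{-i}}u_i(\zeta(s^*_i,s_{-i}))\mu_i(\{s_{-i}\}\mid S_{-i}(h))\ge\sum_{s_{-i}\in S_{-i}}u_i(\zeta(s_i,s_{-i}))\mu_i(\{s_{-i}\}\mid S_{-i}(h))$. *)

(* Defs.v *)
From HB Require Import structures.
From mathcomp Require Import all_boot all_order all_algebra.
From Stdlib Require Import Reals.
From mathcomp Require Import Rstruct.

Set Implicit Arguments.
Unset Strict Implicit.
Unset Printing Implicit Defensive.

Import Order.TTheory GRing.Theory Num.Theory.

Section Game.
Variables (I Act Info : finType).

Definition Prof := {ffun I -> Act}.
Definition Hist := seq Prof.

(* hists  : the finite set X of histories
   avail j x : the actions A_j(x) available to j at x
   info j x  : label of j's information set containing x (only relevant when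
               j is active at x); the information set with label h is
               { x | j active at x, info j x = h }
   pref j z z' : z  ≿_j  z'   (relevant on terminal histories)              *)
Record game := Game {
  hists : seq Hist;
  avail : I -> Hist -> {set Act};
  info  : I -> Hist -> Info;
  pref  : I -> Hist -> Hist -> bool }.

Variable g : game.

Definition nonterm (x : Hist) := [exists a : Prof, rcons x a \in hists g].
Definition terminal (x : Hist) := (x \in hists g) && ~~ nonterm x.
Definition Zs := [seq x <- hists g | terminal x].

Definition active (j : I) (x : Hist) :=
  [&& x \in hists g, nonterm x & 1 < #|avail g j x|].

Definition prefixes (x : Hist) := [seq take k x | k <- iota 0 (size x)].
Definition steps (x : Hist) : seq (Hist * Prof) := zip (prefixes x) x.

Definition experience (i : I) (x : Hist) : seq (Info * Act) :=
  map (fun p : Hist * Prof => (info g i p.1, p.2 i)) [seq p <- steps x | active i p.1].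

Definition wf_game : Prop :=
  [/\ [::] \in hists g,
      (forall x a, rcons x a \in hists g -> x \in hists g),
      (forall x, x \in hists g -> nonterm x ->
          (forall j, avail g j x != set0) /\
          (forall a : Prof, (rcons x a \in hists g) = [forall j, a j \in avail g j x])),
      (forall i x y, active i x -> active i y -> info g i x = info g i y ->
          avail g i x = avail g i y /\ experience i x = experience i y)
    &
      (forall i,
        (forall z z', terminal z -> terminal z' -> pref g i z z' || pref g i z' z) /\
        (forall z1 z2 z3, terminal z1 -> terminal z2 -> terminal z3 ->
            pref g i z1 z2 -> pref g i z2 z3 -> pref g i z1 z3))].

Definition rstrat := {ffun Info -> Act}.
Definition rprof := {ffun I -> rstrat}.

Definition admissible (i : I) (s : rstrat) :=
  all (fun x => active i x ==> (s (info g i x) \in avail g i x)) (hists g).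

Definition follows (σ : I -> rstrat) (x : Hist) :=
  (x \in hists g) &&
  all (fun p : Hist * Prof => [forall j, active j p.1 ==> (p.2 j == σ j (info g j p.1))]) (steps x).

Definition outcome (σ : I -> rstrat) : Hist := head [::] [seq z <- Zs | follows σ z].

Definition inInfo (i : I) (h : Info) (x : Hist) := active i x && (info g i x == h).
Definition isInfo (i : I) (h : Info) := has (inInfo i h) (hists g).
Definition reachesH (σ : I -> rstrat) (i : I) (h : Info) :=
  has (fun x => inInfo i h x && follows σ x) (hists g).

Definition rallows (i : I) (s : rstrat) (h : Info) :=
  [exists σ : rprof, [&& [forall j, admissible j (σ j)], σ i == s & reachesH σ i h]].

Definition beq (i : I) (s t : rstrat) :=
  [forall h, isInfo i h ==>
     ((rallows i s h == rallows i t h) && (rallows i s h ==> (s h == t h)))].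

Definition canon (i : I) (s : rstrat) := odflt s [pick t | admissible i t && beq i s t].

(* strategies = equivalence classes, each represented by its canonical member *)
Definition isStrat (i : I) (s : rstrat) := admissible i s && (canon i s == s).
Definition Strat (i : I) := {s : rstrat | isStrat i s}.

Definition Opp (i : I) := {dffun forall k : {j : I | j != i}, Strat (val k)}.

Definition joint (i : I) (s : Strat i) (o : Opp i) : I -> rstrat :=
  fun j => match (insub j : option {k : I | k != i}) with
           | Some k => val (o k)
           | None => val s
           end.

Definition zeta (i : I) (s : Strat i) (o : Opp i) : Hist := outcome (joint s o).

Definition SiH (i : I) (h : Info) : {set Strat i} :=
  [set s | [exists o : Opp i, reachesH (joint s o) i h]].
Definition SoH (i : I) (h : Info) : {set Opp i} :=
  [set o | [exists s : Strat i, reachesH (joint s o) i h]].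

Definition strict_pref (i : I) (z z' : Hist) := pref g i z z' && ~~ pref g i z' z.

Definition wdom (i : I) (P : {set Strat i}) (Q : {set Opp i}) (s t : Strat i) :=
  [/\ s \in P, t \in P,
      (forall o, o \in Q -> pref g i (zeta t o) (zeta s o))
    & exists2 o, o \in Q & strict_pref i (zeta t o) (zeta s o)].

Definition Bdom (i : I) (P : {set Strat i}) (Q : {set Opp i}) (s : Strat i) :=
  s \in P /\
  forall Q' : {set Opp i}, Q' != set0 -> Q' \subset Q -> exists t, wdom P Q' s t.

Definition restriction := forall j : I, {set Strat j}.
Definition fullR : restriction := fun j => [set: Strat j].
Definition Ropp (i : I) (R : restriction) : {set Opp i} :=
  [set o : Opp i | [forall k, o k \in R (val k)]].

Definition condBdom (i : I) (R : restriction) (s : Strat i) :=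
  s \in R i /\
  exists h, [/\ isInfo i h, s \in SiH i h,
                (R i :&: SiH i h != set0) && (Ropp i R :&: SoH i h != set0)
              & Bdom (R i :&: SiH i h) (Ropp i R :&: SoH i h) s].

Local Open Scope ring_scope.

Definition represents (i : I) (u : Hist -> R) :=
  forall z z', terminal z -> terminal z' -> ((u z' <= u z) <-> pref g i z z').

Definition condev (i : I) (E : {set Opp i}) := [exists h, isInfo i h && (E == SoH i h)].

Definition mass (i : I) (m : Opp i -> R) (A : {set Opp i}) := \sum_(o in A) m o.

(* a CPS on (S_{-i}, 𝓗_i): mu E is the probability mass function μ(·|E) *)
Definition CPS (i : I) (mu : {set Opp i} -> Opp i -> R) :=
  (forall E, condev E ->
     [/\ forall o, 0 <= mu E o, mass (mu E) [set: Opp i] = 1 & mass (mu E) E = 1]) /\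
  (forall (A E E' : {set Opp i}), condev E -> condev E' -> A \subset E' -> E' \subset E ->
     mass (mu E) A = mass (mu E') A * mass (mu E) E').

Definition seqrat (i : I) (s : Strat i) :=
  exists (u : Hist -> R) (mu : {set Opp i} -> Opp i -> R),
    [/\ represents i u, CPS mu &
        forall h, isInfo i h -> s \in SiH i h -> forall t, t \in SiH i h ->
          \sum_(o : Opp i) u (zeta t o) * mu (SoH i h) o
            <= \sum_(o : Opp i) u (zeta s o) * mu (SoH i h) o].

End Game.

(* Main.v *)
From Stdlib Require Import Rdefinitions.
Require Import Defs.
From mathcomp Require Import all_boot all_order all_algebra.
From mathcomp Require Import Rstruct.

(* If s is undominated, choose at each information set h that s allows a nonempty
   set Q_h of opponents' profiles on which no strategy allowing h weakly dominates
   s. List these information sets by increasing depth, and let the belief on an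
   event E be supported on E :&: Q_h for the first h where this is nonempty.
   Supports chosen in this lexicographic way always satisfy the chain rule. At an
   information set k that s allows, the chosen h precedes k, and s is still
   undominated at k on SoH k :&: Q_h, since a dominating strategy could be spliced
   with s into one that dominates s at h on Q_h.
   The utility and the weights are the same at all information sets: for M large,
   u z = - M ^- rank z and o has weight M ^ rank (zeta s o). The weighted payoff of
   s is then -1 at each o, while any gain is worth at most 1 and any loss costs at
   least M - 1. *)

Set Implicit Arguments.
Unset Strict Implicit.
Unset Printing Implicit Defensive.

Import Order.TTheory GRing.Theory Num.Theory.

(** * Prefixes and counting in sequences *)

Section SeqComplements.
Context {T : eqType}.
Implicit Types s t : seq T.

Lemma prefix_rconsr s t x : prefix s (rcons t x) = (s == rcons t x) || prefix s t.
Proof.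
elim: t s => [|y t IHt] [|z s] //=; first by rewrite eqseq_cons orbF; case: s.
by rewrite IHt eqseq_cons; case: (z == y).
Qed.

Lemma proper_prefix s t : prefix s t -> s = t \/ exists x, prefix (rcons s x) t.
Proof.
case/prefixP=> -[|x u] ->; first by left; rewrite cats0.
by right; exists x; rewrite -cat_rcons prefix_prefix.
Qed.

Lemma prefix_comparable s t u : prefix s u -> prefix t u -> prefix s t || prefix t s.
Proof.
elim: u s t => [|x u IHu] [|y s] [|z t] //= /andP[/eqP-> su] /andP[/eqP-> tu].
by rewrite !eqxx /= IHu.
Qed.

Lemma ltn_count (a b : pred T) s x :
  subpred a b -> x \in s -> b x -> ~~ a x -> count a s < count b s.
Proof.
move=> ab + bx ax; elim: s => //= y s IHs; rewrite in_cons => /orP[/eqP<-|/IHs lt].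
  by rewrite bx (negPf ax) add0n add1n ltnS sub_count.
by rewrite -addnS leq_add //; case: (a y) (ab y) => // ->.
Qed.

End SeqComplements.

(** * Histories, experiences and plays *)

Section Plays.
Context {I Act Info : finType} (g : game I Act Info).
Implicit Types (x y z p : Hist I Act) (a b : Prof I Act) (j : I) (h k : Info)
  (σ τ : I -> rstrat Act Info) (t : rstrat Act Info).

Lemma steps_rcons x a : steps (rcons x a) = rcons (steps x) (x, a).
Proof.
rewrite /steps /prefixes size_rcons -addn1 iotaD map_cat /= -!cats1.
rewrite zip_cat ?size_map ?size_iota //= take_size_cat //; congr (zip _ _ ++ _).
by apply/eq_in_map => n; rewrite mem_iota => /andP[_ ltn]; rewrite takel_cat // ltnW.
Qed.

Lemma mem_steps x p a : ((p, a) \in steps x) = prefix (rcons p a) x.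
Proof.
elim/last_ind: x => [|x b IHx]; first by rewrite prefixs0 -size_eq0 size_rcons.
by rewrite steps_rcons mem_rcons in_cons IHx prefix_rconsr eqseq_rcons xpair_eqE.
Qed.

Lemma followsP σ x :
  reflect (x \in hists g /\ forall p a j, prefix (rcons p a) x -> active g j p ->
             a j = σ j (info g j p))
          (follows g σ x).
Proof.
apply: (iffP andP) => -[gx H]; split=> //.
  move=> p a j pax actp; rewrite -mem_steps in pax.
  by have/forallP/(_ j)/implyP/(_ actp)/eqP := allP H _ pax.
apply/allP=> -[p a] /=; rewrite mem_steps => pax.
by apply/forallP=> j; apply/implyP=> actp; apply/eqP/H.
Qed.

Lemma follows_eq σ τ : σ =1 τ -> follows g σ =1 follows g τ.
Proof.
move=> e x; apply/followsP/followsP=> -[gx H]; split=> // p a j pax actp.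
  by rewrite -e; apply: H.
by rewrite e; apply: H.
Qed.

Lemma experience_rcons j x a :
  experience g j (rcons x a) =
  experience g j x ++ (if active g j x then [:: (info g j x, a j)] else [::]).
Proof.
rewrite /experience steps_rcons filter_rcons /=.
by case: ifP => _; rewrite ?cats0 // map_rcons cats1.
Qed.

(** Passing through [p] adds to the experience the entry recorded at [p]. With perfect recall this
    keeps a play from visiting an information set twice. *)
Lemma size_experience_lt j p a x :
  active g j p -> prefix (rcons p a) x ->
  size (experience g j p) < size (experience g j x).
Proof.
move=> actp /prefixP[q ->]; elim/last_ind: q => [|q b IHq].
  by rewrite cats0 experience_rcons actp size_cat addn1.
rewrite -rcons_cat experience_rcons size_cat.
exact: leq_trans IHq (leq_addr _ _).
Qed.

Lemma experienceP j h (b : Act) x :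
  reflect (exists p a, [/\ prefix (rcons p a) x, active g j p, info g j p = h & a j = b])
          ((h, b) \in experience g j x).
Proof.
apply: (iffP mapP) => [[[p a]]|[p [a [pax actp <- <-]]]].
  rewrite mem_filter mem_steps /= => /andP[actp pax] [-> ->].
  by exists p, a.
by exists (p, a); rewrite // mem_filter mem_steps actp.
Qed.

Lemma active_hist j x : active g j x -> x \in hists g.
Proof. by case/and3P. Qed.

Lemma reachesHP σ j h :
  reflect (exists2 x, inInfo g j h x & follows g σ x) (reachesH g σ j h).
Proof.
apply: (iffP hasP) => [[x _ /andP[hx sx]]|[x hx sx]]; first by exists x.
by exists x; rewrite ?hx //; case/andP: hx => /active_hist.
Qed.

Lemma isInfoP j h : reflect (exists x, inInfo g j h x) (isInfo g j h).
Proof.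
apply: (iffP hasP) => [[x _ hx]|[x hx]]; first by exists x.
by exists x; rewrite ?hx //; case/andP: hx => /active_hist.
Qed.

Lemma ZsE x : (x \in Zs g) = terminal g x.
Proof. by rewrite mem_filter; case tx: (terminal g x) => //=; case/andP: tx. Qed.

(** * Plays in games with perfect recall *)

Section WellFormed.
Hypothesis wfg : wf_game g.

Lemma hist_nil : [::] \in hists g. Proof. by case: wfg. Qed.

Lemma hist_prefix p x : prefix p x -> x \in hists g -> p \in hists g.
Proof.
case/prefixP=> q ->; elim/last_ind: q => [|q b IHq]; first by rewrite cats0.
by rewrite -rcons_cat; case: wfg => _ H _ _ _ /H.
Qed.

Lemma hist_rcons x a :
  rcons x a \in hists g ->
  [/\ x \in hists g, nonterm g x & forall j, a j \in avail g j x].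
Proof.
move=> gxa; have [_ Hp Ha _ _] := wfg.
have gx := Hp _ _ gxa; have nx : nonterm g x by apply/existsP; exists a.
by split=> //; case: (Ha x gx nx) => _ /(_ a); rewrite gxa => /esym/forallP.
Qed.

Lemma info_avail j x y :
  active g j x -> active g j y -> info g j x = info g j y -> avail g j x = avail g j y.
Proof. by case: wfg => _ _ _ H _ ax ay e; case: (H j x y ax ay e). Qed.

Lemma info_experience j h x y :
  inInfo g j h x -> inInfo g j h y -> experience g j x = experience g j y.
Proof.
case/andP=> ax /eqP ex /andP[ay /eqP ey].
by case: wfg => _ _ _ H _; case: (H j x y ax ay); rewrite ?ex ?ey.
Qed.

Lemma follows_prefix σ p x : prefix p x -> follows g σ x -> follows g σ p.
Proof.
move=> px /followsP[gx H]; apply/followsP; split; first exact: hist_prefix gx.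
by move=> q a j qap; apply: H; apply: prefix_trans px.
Qed.

(** Two followed histories cannot branch: at a common node the profile fixes the action of each
    active player, and an inactive player has at most one action available. *)
Lemma follows_comparable σ x y : follows g σ x -> follows g σ y -> prefix x y || prefix y x.
Proof.
move=> sx sy; elim/last_ind: x sx => [|x a IHx] sxa; first by rewrite prefix0s.
have px : prefix x (rcons x a) by apply: prefix_rcons.
case/orP: (IHx (follows_prefix px sxa)) => [xy|yx]; last first.
  by rewrite orbC (prefix_trans yx px).
case: (proper_prefix xy) => [<-|[b xby]]; first by rewrite px orbT.
suff -> : a = b by rewrite xby.
have /followsP[gxa Ha] := sxa; have /followsP[gy Hb] := sy.
have [gx nx avx] := hist_rcons gxa.
have [_ _ bvx] := hist_rcons (hist_prefix xby gy).
apply/ffunP=> j; have [actx|] := boolP (active g j x).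
  by rewrite (Ha x a) ?prefix_refl // (Hb x b).
rewrite /active gx nx /= -leqNgt => le1.
by apply: (card_le1_eqP le1).
Qed.

Lemma terminal_max z x : terminal g z -> x \in hists g -> prefix z x -> x = z.
Proof.
case/andP=> _ nz gx /proper_prefix[//|[a zax]].
by case/negP: nz; apply/existsP; exists a; apply: hist_prefix gx.
Qed.

Lemma outcome_uniq σ z : terminal g z -> follows g σ z -> outcome g σ = z.
Proof.
move=> tz sz; rewrite /outcome.
case E: [seq _ <- _ | _] => [|z' l].
  have : z \in [seq z <- Zs g | follows g σ z] by rewrite mem_filter sz ZsE.
  by rewrite E.
have : z' \in [seq z <- Zs g | follows g σ z] by rewrite E mem_head.
rewrite mem_filter ZsE /= => /andP[sz' tz'].
have gz : z \in hists g by case/andP: tz.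
have gz' : z' \in hists g by case/andP: tz'.
by case/orP: (follows_comparable sz sz') => H; [|symmetry]; apply: (terminal_max _ _ H).
Qed.

Lemma outcomeP σ :
  (forall j, admissible g j (σ j)) -> terminal g (outcome g σ) /\ follows g σ (outcome g σ).
Proof.
move=> adm.
suff [z tz sz] : exists2 z, terminal g z & follows g σ z by rewrite (outcome_uniq tz sz).
pose N := \max_(x <- hists g) size x.
(* Following [σ] step by step either ends in a terminal history or exceeds every length, which the
   bound [N] rules out. *)
suff ext n : (exists2 z, terminal g z & follows g σ z) \/
    exists2 x, follows g σ x & n <= size x.
  case: (ext N.+1) => // -[x /followsP[gx _]].
  by rewrite ltnNge /N (leq_bigmax_seq _ gx).
elim: n => [|n [|[x sx nx]]]; [|by left|].
  right; exists [::] => //; apply/followsP; split; first exact: hist_nil.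
  by move=> p a j; rewrite prefixs0 -size_eq0 size_rcons.
have /followsP[gx H] := sx.
have [nt|tx] := boolP (nonterm g x); last by left; exists x; rewrite // /terminal gx.
have [_ _ /(_ x gx nt) [av0 av] _ _] := wfg.
have b0 j : exists b : Act, b \in avail g j x by apply/set0Pn.
pose a : Prof I Act := [ffun j =>
  if active g j x then σ j (info g j x) else xchoose (b0 j)].
have gxa : rcons x a \in hists g.
  rewrite av; apply/forallP=> j; rewrite ffunE; case: ifP => [actx|_]; last exact: xchooseP.
  by have /allP/(_ x gx)/implyP := adm j; apply.
right; exists (rcons x a); last by rewrite size_rcons ltnS.
apply/followsP; split=> // p b j; rewrite prefix_rconsr => /orP[/eqP/rcons_inj[-> ->]|].
  by move=> actx; rewrite ffunE actx.
exact: H.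
Qed.

Lemma outcome_sub σ τ :
  (forall j, admissible g j (σ j)) -> (forall x, follows g σ x -> follows g τ x) ->
  outcome g σ = outcome g τ.
Proof.
by move=> adm H; have [tz sz] := outcomeP adm; symmetry; apply: outcome_uniq; rewrite ?H.
Qed.

Lemma reachesH_sub σ τ j h :
  (forall x, follows g σ x -> follows g τ x) -> reachesH g σ j h -> reachesH g τ j h.
Proof. by move=> H /reachesHP[x hx sx]; apply/reachesHP; exists x; rewrite ?H. Qed.

(* By perfect recall an information set occurs at most once on a play, so the
   actions leading to [x] can be prescribed consistently. *)
Lemma hist_reached (a0 : Act) x : x \in hists g ->
  exists2 σ : I -> rstrat Act Info, (forall j, admissible g j (σ j)) & follows g σ x.
Proof.
move=> gx.
pose st j k := [seq p <- steps x | active g j p.1 && (info g j p.1 == k)].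
(* Off the way to [x], an action available at one member of the information set is admissible at all
   of them; [a0] only fills labels that name no information set of [j]. *)
pose dflt j k := if ohead [seq y <- hists g | inInfo g j k y] is Some y
                 then odflt a0 [pick b in avail g j y] else a0.
pose σ j : rstrat Act Info :=
  [ffun k => if ohead (st j k) is Some p then p.2 j else dflt j k].
have stP j k (p : Hist I Act * Prof I Act) : ohead (st j k) = Some p ->
    [/\ prefix (rcons p.1 p.2) x, active g j p.1 & info g j p.1 = k].
  case E: (st j k) => [//|q l] [<-{p}].
  have : q \in st j k by rewrite E mem_head.
  by rewrite mem_filter => /andP[/andP[-> /eqP->]]; rewrite -mem_steps -surjective_pairing.
exists σ => [j|].
  apply/allP=> y gy; apply/implyP=> ay; rewrite ffunE.
  case E: (ohead _) => [p|].
    have [px ap e] := stP _ _ _ E; rewrite -(info_avail ap ay e).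
    by have [] := hist_rcons (hist_prefix px gx).
  rewrite /dflt; case F: [seq _ <- _ | _] => [|y' l] /=.
    have : y \in [seq y' <- hists g | inInfo g j (info g j y) y'].
      by rewrite mem_filter gy /inInfo ay eqxx.
    by rewrite F.
  have : y' \in [seq y' <- hists g | inInfo g j (info g j y) y'] by rewrite F mem_head.
  rewrite mem_filter => /andP[/andP[ay' /eqP e] _].
  rewrite (info_avail ay' ay e).
  case: pickP => //= no; case/and3P: ay => _ _; rewrite ltnNge (eq_card0 no) //.
apply/followsP; split=> // p a j pax actp; rewrite ffunE.
case E: (ohead _) => [q|]; last first.
  case F: (st j (info g j p)) E => [|//] _.
  have : (p, a) \in st j (info g j p) by rewrite mem_filter mem_steps pax /= actp eqxx.
  by rewrite F.
have [qx aq e] := stP _ _ _ E.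
have eexp : experience g j q.1 = experience g j p.
  by apply: (@info_experience j (info g j p)); rewrite /inInfo ?aq ?actp ?e eqxx.
case/orP: (prefix_comparable qx pax) => H.
  move: H; rewrite prefix_rconsr => /orP[/eqP/rcons_inj[_ ->]//|H].
  by have := size_experience_lt aq H; rewrite eexp ltnn.
move: H; rewrite prefix_rconsr => /orP[/eqP/rcons_inj[_ ->]//|H].
by have := size_experience_lt actp H; rewrite eexp ltnn.
Qed.

(** [beq] compares actions only at information sets that [σ j] allows; those met along a history
    followed by [σ] are allowed, with [σ] itself as witness. *)
Lemma beq_follows σ τ x :
  (forall j, admissible g j (σ j)) -> (forall j, beq g j (σ j) (τ j)) ->
  follows g σ x -> follows g τ x.
Proof.
move=> adm eqst sx; have /followsP[gx H] := sx.
apply/followsP; split=> // p a j pax actp; rewrite (H p a) //.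
have /forallP/(_ (info g j p)) := eqst j.
have -> : isInfo g j (info g j p) by apply/isInfoP; exists p; rewrite /inInfo actp eqxx.
case/andP=> _ /implyP eqs; apply/eqP/eqs.
apply/existsP; exists [ffun j => σ j]; rewrite ffunE eqxx /=.
have e : ([ffun j => σ j] : rprof I Act Info) =1 σ by move=> j'; rewrite ffunE.
apply/andP; split; first by apply/forallP=> j'; rewrite e.
apply/reachesHP; exists p; first by rewrite /inInfo actp eqxx.
rewrite (follows_eq e); apply: follows_prefix sx.
exact: prefix_trans (prefix_rcons _ _) pax.
Qed.

End WellFormed.

(** * Behavioral equivalence and canonical representatives *)

Lemma beq_refl j t : beq g j t t.
Proof. by apply/forallP=> h; rewrite !eqxx implybT implybT. Qed.

Lemma beqP j t t' :
  reflect (forall h, isInfo g j h ->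
             rallows g j t h = rallows g j t' h /\ (rallows g j t h -> t h = t' h))
          (beq g j t t').
Proof.
apply: (iffP forallP) => H h.
  by move=> ih; have /implyP/(_ ih)/andP[/eqP ? /implyP e] := H h; split=> // /e/eqP.
by apply/implyP=> /H[e f]; rewrite e eqxx /= -e; apply/implyP=> /f->.
Qed.

Lemma beq_sym j t t' : beq g j t t' -> beq g j t' t.
Proof.
move/beqP=> H; apply/beqP=> h ih; have [e f] := H h ih.
by split=> // r; rewrite f // e.
Qed.

Lemma beq_trans j t1 t2 t3 : beq g j t1 t2 -> beq g j t2 t3 -> beq g j t1 t3.
Proof.
move=> /beqP H /beqP H'; apply/beqP=> h ih; have [e f] := H h ih; have [e' f'] := H' h ih.
by split=> [|r]; rewrite ?e // f // f' // -e.
Qed.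

Lemma canonP j t : admissible g j t -> isStrat g j (canon g j t) /\ beq g j t (canon g j t).
Proof.
move=> adm; pose P u v := admissible g j v && beq g j u v.
have [u Pu E] : exists2 u, P t u & [pick v | P t v] = Some u.
  by case: pickP => [u Pu|/(_ t)]; [exists u | rewrite /P adm beq_refl].
have -> : canon g j t = u by rewrite /canon E.
case/andP: Pu => admu tu; split=> //; rewrite /isStrat admu /canon.
(* Picking from the class of [u] or from that of [t] is the same search, so [canon] fixes [u]. *)
rewrite (@eq_pick _ _ (P t)) ?E //= => v; rewrite /P; congr andb.
by apply/idP/idP; apply: beq_trans => //; apply: beq_sym.
Qed.

End Plays.

(** * Strategies, splicing and weak dominance *)

Section Strategies.
Context {I Act Info : finType} {g : game I Act Info} {i : I}.
Hypothesis wfg : wf_game g.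
Implicit Types (x y z : Hist I Act) (h k : Info) (s t v : Strat g i) (o : Opp g i)
  (r : rstrat Act Info).

(** A spliced strategy need not be a canonical representative, so profiles are first formed with a
    raw [r]; [joint s o] is [rjoint (val s) o] by conversion. *)
Definition rjoint r o : I -> rstrat Act Info :=
  fun j => if insub j is Some k then val (o k) else r.

Lemma rjoint_self r o : rjoint r o i = r.
Proof. by rewrite /rjoint insubF ?eqxx. Qed.

Lemma rjoint_opp r r' o j : j != i -> rjoint r o j = rjoint r' o j.
Proof. by move=> ne; rewrite /rjoint insubT. Qed.

Lemma rjoint_admissible r o : admissible g i r -> forall j, admissible g j (rjoint r o j).
Proof.
move=> adm j; rewrite /rjoint; case: insubP => [k _ <-|]; last by rewrite negbK => /eqP->.
by case: (o k) => u /= /andP[].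
Qed.

Lemma strat_admissible s : admissible g i (val s).
Proof. by case/andP: (valP s). Qed.

Lemma joint_admissible s o j : admissible g j (joint s o j).
Proof. exact: (rjoint_admissible o (strat_admissible s)). Qed.

Lemma rjoint_canon r : admissible g i r ->
  exists v, forall o x, follows g (rjoint r o) x -> follows g (joint v o) x.
Proof.
move=> adm; have [cs cb] := canonP adm.
exists (Sub (canon g i r) cs) => o x.
apply: beq_follows => // j; first exact: rjoint_admissible.
change (beq g j (rjoint r o j) (rjoint (canon g i r) o j)).
have [->|ne] := eqVneq j i; first by rewrite !rjoint_self.
by rewrite (rjoint_opp _ (canon g i r)) ?beq_refl.
Qed.

Lemma profile_canon (σ : I -> rstrat Act Info) : (forall j, admissible g j (σ j)) ->
  exists s o, forall x, follows g σ x -> follows g (joint s o) x.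
Proof.
move=> adm.
pose c j : Strat g j := Sub (canon g j (σ j)) (canonP (adm j)).1.
exists (c i), [ffun k : {j | j != i} => c (val k)] => x.
apply: beq_follows => // j; rewrite /joint.
case: insubP => [k _ <-|]; rewrite ?ffunE; first exact: (canonP _).2.
by rewrite negbK => /eqP->; apply: (canonP _).2.
Qed.

Lemma reaches_SiH s o h : reachesH g (joint s o) i h -> s \in SiH g i h.
Proof. by move=> r; rewrite inE; apply/existsP; exists o. Qed.

Lemma reaches_SoH s o h : reachesH g (joint s o) i h -> o \in SoH g i h.
Proof. by move=> r; rewrite inE; apply/existsP; exists s. Qed.

Lemma SoH_neq0 (a0 : Act) h : isInfo g i h -> SoH g i h != set0.
Proof.
case/isInfoP=> x hx; have gx : x \in hists g by case/andP: hx => /active_hist.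
have [σ adm sx] := hist_reached wfg a0 gx.
have [s [o so]] := profile_canon adm.
by apply/set0Pn; exists o; apply: (@reaches_SoH s); apply/reachesHP; exists x; rewrite ?so.
Qed.

Lemma follows_own r o x k (b : Act) :
  follows g (rjoint r o) x -> (k, b) \in experience g i x -> r k = b.
Proof.
case/followsP=> _ H /experienceP[p [a [pax actp <- <-]]].
by rewrite (H _ _ _ pax actp) rjoint_self.
Qed.

Lemma follows_change r r' o x :
  follows g (rjoint r o) x ->
  (forall k (b : Act), (k, b) \in experience g i x -> r k = b -> r' k = b) ->
  follows g (rjoint r' o) x.
Proof.
move=> rx H; have /followsP[gx Hr] := rx; apply/followsP; split=> // p a j pax actp.
have [e|ne] := eqVneq j i; last by rewrite (rjoint_opp _ r) //; apply: Hr.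
rewrite e rjoint_self in actp *; symmetry.
have E : (info g i p, a i) \in experience g i x by apply/experienceP; exists p, a.
exact: (H _ _ E (follows_own rx E)).
Qed.

(** All histories in [h] carry the same experience, so the own choices that bring [s] to one of them
    are those needed for any other. This gives the product form of the profiles reaching [h]. *)
Lemma SiH_SoH s o h : s \in SiH g i h -> o \in SoH g i h -> reachesH g (joint s o) i h.
Proof.
rewrite !inE => /existsP[o' /reachesHP[x hx sx]] /existsP[s' /reachesHP[y hy sy]].
apply/reachesHP; exists y => //.
apply: (follows_change (r := val s')) => // k b + _.
by rewrite -(info_experience wfg hx hy); apply: follows_own sx.
Qed.

(** Counts the own moves of [i] before [h]; the history taken from [h] is arbitrary, since perfect
    recall makes the count the same for all. *)
Definition dep h := size (experience g i (head [::] [seq x <- hists g | inInfo g i h x])).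

Lemma depE h x : inInfo g i h x -> dep h = size (experience g i x).
Proof.
move=> hx; rewrite /dep; case E: [seq _ <- _ | _] => [|y l].
  have : x \in [seq y <- hists g | inInfo g i h y].
    by rewrite mem_filter hx; case/andP: hx => /active_hist.
  by rewrite E.
have : y \in [seq y <- hists g | inInfo g i h y] by rewrite E mem_head.
by rewrite mem_filter => /andP[hy _]; rewrite (info_experience wfg hx hy).
Qed.

(** On the common play [h0] comes no later than [h]. If it comes strictly earlier, the experience at
    [h] records it, and all histories in [h] share that experience. *)
Lemma reaches_earlier s o h0 h :
  reachesH g (joint s o) i h0 -> reachesH g (joint s o) i h -> dep h0 <= dep h ->
  forall t o', reachesH g (joint t o') i h -> reachesH g (joint t o') i h0.
Proof.
case/reachesHP=> x0 hx0 sx0 /reachesHP[x hx sx] le t o' /reachesHP[y hy ty].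
have act h' x' : inInfo g i h' x' -> active g i x' by case/andP.
have : prefix x0 x.
  case/orP: (follows_comparable wfg sx0 sx) => // /proper_prefix[->|[a]].
    exact: prefix_refl.
  by move/(size_experience_lt (act _ _ hx)); rewrite -(depE hx) -(depE hx0) ltnNge le.
case/proper_prefix=> [e|[a ax]].
  apply/reachesHP; exists y => //.
  by move: hx0 hx hy; rewrite e /inInfo => /andP[_ /eqP<-] /andP[_ /eqP<-].
have : (h0, a i) \in experience g i x.
  by apply/experienceP; exists x0, a; case/andP: hx0 => ? /eqP.
rewrite (info_experience wfg hx hy) => /experienceP[p [b [pby actp e _]]].
apply/reachesHP; exists p; first by rewrite /inInfo actp e eqxx.
by apply: (follows_prefix wfg) ty; apply: prefix_trans pby; apply: prefix_rcons.
Qed.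

(* [v] plays like [t] from [h] on and like [s] elsewhere; as both allow [h], they
   prescribe the same actions before it, by perfect recall. *)
Lemma splice s t h : s \in SiH g i h -> t \in SiH g i h ->
  exists v, forall o x,
    follows g (joint (if o \in SoH g i h then t else s) o) x -> follows g (joint v o) x.
Proof.
move=> hs ht.
pose after k := (k == h) ||
  has (fun x => inInfo g i k x && (h \in unzip1 (experience g i x))) (hists g).
have afterP x : active g i x -> after (info g i x) ->
    exists2 y, inInfo g i h y & prefix y x.
  move=> ax /orP[/eqP e|/hasP[y _ /andP[hy]]].
    by exists x; rewrite ?prefix_refl // /inInfo ax e eqxx.
  have hx : inInfo g i (info g i x) x by rewrite /inInfo ax eqxx.
  rewrite (info_experience wfg hy hx) => /mapP[[h' b] /experienceP[p [a [pax ap e _]]] /= ->].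
  exists p; first by rewrite /inInfo ap e eqxx.
  exact: prefix_trans (prefix_rcons _ _) pax.
have prefix_after x y : active g i x -> inInfo g i h y -> prefix y x -> after (info g i x).
  move=> ax hy /proper_prefix[<-|[a yax]]; apply/orP; first by left; case/andP: hy.
  right; apply/hasP; exists x; first exact: active_hist ax.
  rewrite /inInfo ax eqxx /=; apply/mapP; exists (h, a i) => //.
  by apply/experienceP; exists y, a; case/andP: hy => ? /eqP.
pose r : rstrat Act Info := [ffun k => if after k then val t k else val s k].
have adm : admissible g i r.
  apply/allP=> x gx; apply/implyP=> ax; rewrite ffunE; case: ifP => _.
    by have /allP/(_ x gx)/implyP := strat_admissible t; apply.
  by have /allP/(_ x gx)/implyP := strat_admissible s; apply.
have [v rv] := rjoint_canon adm; exists v => o x; move=> H; apply: rv; move: H.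
case: ifPn => ho H; apply: (follows_change H) => k b kb; rewrite ffunE.
  case: ifPn => // nk tk.
  have [p [a [pax ap e ai]]] := experienceP _ _ _ _ _ kb.
  have /reachesHP[y hy ty] := SiH_SoH ht ho.
  have /reachesHP[y' hy' sy'] := SiH_SoH hs ho.
  have tp := follows_prefix wfg (prefix_trans (prefix_rcons _ _) pax) H.
  (* A history at a set not after [h] lies strictly before [y]; its choice belongs to the experience
     at [h], which [s] shares. *)
  case/orP: (follows_comparable wfg ty tp) => [yp|py].
    by rewrite -e (prefix_after p y) in nk.
  case: (proper_prefix py) => [epy|[a' pay]].
    by rewrite -e (prefix_after p y) // epy prefix_refl in nk.
  have ky : (k, a' i) \in experience g i y by apply/experienceP; exists p, a'.
  rewrite -tk (follows_own ty ky); rewrite (info_experience wfg hy hy') in ky.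
  exact: follows_own sy' ky.
(* Against opponents outside [SoH g i h] the play of [s] never meets [h], hence no set after it
   either. *)
case: ifPn => // ak _; case/negP: ho.
have [p [a [pax ap e ai]]] := experienceP _ _ _ _ _ kb.
rewrite -e in ak; have [y hy yp] := afterP _ ap ak.
apply: (@reaches_SoH s); apply/reachesHP; exists y => //.
by apply: (follows_prefix wfg) H; apply: prefix_trans yp (prefix_trans (prefix_rcons _ _) pax).
Qed.

Lemma zeta_terminal s o : terminal g (zeta s o).
Proof. by case: (outcomeP wfg (joint_admissible s o)). Qed.

Lemma pref_refl z : terminal g z -> pref g i z z.
Proof. by move=> tz; case: wfg => _ _ _ _ /(_ i)[tot _]; have := tot z z tz tz; rewrite orbb. Qed.

Lemma prefNge z z' : terminal g z -> terminal g z' -> ~~ pref g i z z' -> strict_pref g i z' z.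
Proof.
move=> tz tz' n; rewrite /strict_pref n andbT.
by case: wfg => _ _ _ _ /(_ i)[/(_ _ _ tz tz')]; rewrite (negPf n).
Qed.

Definition wdomb (Q : {set Opp g i}) s t :=
  [forall o in Q, pref g i (zeta t o) (zeta s o)] &&
  [exists o in Q, strict_pref g i (zeta t o) (zeta s o)].

Lemma wdomP (P : {set Strat g i}) Q s t :
  s \in P -> t \in P -> wdomb Q s t -> wdom P Q s t.
Proof.
move=> Ps Pt /andP[/forallP H /existsP[o /andP[oQ so]]]; split=> //; last by exists o.
by move=> o' o'Q; have := H o'; rewrite o'Q.
Qed.

Definition undominated h (Q : {set Opp g i}) s := [forall t in SiH g i h, ~~ wdomb Q s t].

Lemma undominated_later s h0 h (Q : {set Opp g i}) :
  s \in SiH g i h ->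
  (forall t o, reachesH g (joint t o) i h -> reachesH g (joint t o) i h0) ->
  undominated h0 Q s -> undominated h (SoH g i h :&: Q) s.
Proof.
move=> hs earlier und; apply/forallP=> t; apply/implyP=> ht; apply/negP.
case/andP=> /forallP pre /existsP[o /andP[/setIP[ho Qo] str]].
have [v sub] := splice hs ht.
have zv o' : zeta v o' = zeta (if o' \in SoH g i h then t else s) o'.
  by symmetry; apply: (outcome_sub wfg (joint_admissible _ _)) => x; apply: sub.
(* Against [o] the splice reaches [h] as [t] does, and plays reaching [h] pass through [h0], so [v]
   competes with [s] at [h0]. *)
have hv : v \in SiH g i h0.
  apply: (@reaches_SiH _ o); apply: earlier.
  by apply: (reachesH_sub (sub o)); rewrite ho; apply: SiH_SoH.
have /forallP/(_ v) := und; rewrite hv => /negP[]; apply/andP; split; last first.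
  by apply/existsP; exists o; rewrite Qo zv ho.
apply/forallP=> o'; apply/implyP=> Qo'; rewrite zv; case: ifP => ho'.
  by have := pre o'; rewrite inE ho' Qo'.
exact: pref_refl (zeta_terminal _ _).
Qed.

Lemma condBdom_full s : condBdom (fullR g) s <->
  exists h, [/\ isInfo g i h, s \in SiH g i h & Bdom (SiH g i h) (SoH g i h) s].
Proof.
have eS h : fullR g i :&: SiH g i h = SiH g i h by apply/setP=> t; rewrite !inE.
have eO h : Ropp i (fullR g) :&: SoH g i h = SoH g i h.
  by apply/setP=> o; rewrite !inE andb_idl // => _; apply/forallP=> k; rewrite inE.
split=> [[_ [h [ih hs _]]]|[h [ih hs dom]]]; first by rewrite eS eO; exists h.
split; first by rewrite inE.
exists h; rewrite eS eO; split=> //; apply/andP; split; apply/set0Pn; first by exists s.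
by move: hs; rewrite inE => /existsP[o /reaches_SoH]; exists o.
Qed.

Lemma condBdomPn s : ~ condBdom (fullR g) s ->
  forall h, isInfo g i h -> s \in SiH g i h ->
  exists Q : {set Opp g i}, [&& Q != set0, Q \subset SoH g i h & undominated h Q s].
Proof.
move=> nB h ih hs.
case: (pickP (fun Q : {set Opp g i} => [&& Q != set0, Q \subset SoH g i h & undominated h Q s])).
  by move=> Q; exists Q.
move=> none; case: nB; apply/condBdom_full; exists h; do 2?split=> //.
move=> Q Q0 QS; have := none Q; rewrite Q0 QS /= => /negbT.
rewrite negb_forall => /existsP[t]; rewrite negb_imply negbK => /andP[ht d].
by exists t; apply: wdomP.
Qed.

End Strategies.

(** * Lexicographic supports and conditional beliefs *)

Section Layers.
Context {T : finType}.
Implicit Types (A E L Q : {set T}) (Ls : seq {set T}).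

(** The default [E], used if no layer meets [E], keeps supports nonempty on nonempty events. *)
Fixpoint top Ls E :=
  if Ls is L :: Ls' then if E :&: L != set0 then E :&: L else top Ls' E else E.

Lemma top_sub Ls E : top Ls E \subset E.
Proof. by elim: Ls => //= L Ls IH; case: ifP => _ //; apply: subsetIl. Qed.

Lemma top_neq0 Ls E : E != set0 -> top Ls E != set0.
Proof. by move=> E0; elim: Ls => //= L Ls IH; case: ifP. Qed.

(** A layer skipped for [E] is skipped for [E'] too, and by assumption the search for [E'] stops no
    later than that for [E]. *)
Lemma top_subset Ls E E' :
  E' \subset E -> E' :&: top Ls E != set0 -> top Ls E' = E' :&: top Ls E.
Proof.
move=> EE; elim: Ls => [|L Ls IH] /=; first by move/setIidPl: EE => ->.
case: ifPn => [_|]; first by rewrite setIA (setIidPl EE) => ->.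
rewrite negbK => /eqP EL H; rewrite IH //.
suff -> : E' :&: L = set0 by rewrite eqxx.
by apply/eqP; rewrite -subset0 -EL setSI.
Qed.

(** The search stops at [h] at the latest, and whatever precedes [h] in the sorted list is no
    deeper. *)
Lemma top_sorted (K : eqType) (d : K -> nat) (Q : K -> {set T}) (r : seq K) h E :
  sorted (relpre d leq) r -> h \in r -> E :&: Q h != set0 ->
  exists k, [/\ k \in r, d k <= d h, E :&: Q k != set0 & top (map Q r) E = E :&: Q k].
Proof.
elim: r => //= k r IHr; rewrite path_sortedE; last by move=> ? ? ?; apply: leq_trans.
case/andP=> /allP le so; rewrite in_cons => hr EQ.
case: ifPn => [Ek|].
  exists k; split; rewrite ?mem_head //.
  by case/orP: hr => [/eqP->//|]; apply: le.
case/orP: hr => [/eqP<-|hr nEk]; first by rewrite EQ.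
by have [k' [kr lek Ek e]] := IHr so hr EQ; exists k'; split; rewrite // in_cons kr orbT.
Qed.

Local Open Scope ring_scope.
Context {F : realFieldType} (w : T -> F).
Hypothesis w_gt0 : forall o, 0 < w o.

(** One weight function [w] serves all events and is only renormalized on each support; this is what
    makes the chain rule work. *)
Definition belief Ls E o :=
  if o \in top Ls E then w o / \sum_(o' in top Ls E) w o' else 0.

Lemma sum_weight_gt0 E : E != set0 -> 0 < \sum_(o in E) w o.
Proof.
case/set0Pn=> o oE; rewrite (big_setD1 o) //=.
by apply: ltr_wpDr (w_gt0 o); apply: sumr_ge0 => o' _; apply: ltW.
Qed.

Lemma belief_ge0 Ls E o : 0 <= belief Ls E o.
Proof.
rewrite /belief; case: ifP => // _.
by rewrite divr_ge0 ?sumr_ge0 // => *; apply: ltW.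
Qed.

Lemma sum_belief Ls E A :
  \sum_(o in A) belief Ls E o = (\sum_(o in A :&: top Ls E) w o) / \sum_(o in top Ls E) w o.
Proof.
rewrite mulr_suml [RHS](eq_bigl (fun o => (o \in A) && (o \in top Ls E))) => [|o].
  by rewrite big_mkcondr.
by rewrite inE.
Qed.

Lemma sum_belief1 Ls E A : E != set0 -> E \subset A -> \sum_(o in A) belief Ls E o = 1.
Proof.
move=> E0 EA; rewrite sum_belief (setIidPr (subset_trans (top_sub _ _) EA)).
by rewrite divff // gt_eqF // sum_weight_gt0 // top_neq0.
Qed.

(** If [E'] misses the support for [E], both sides vanish. Otherwise the support for [E'] is the
    trace on [E'] of that for [E], and its normalizing constant cancels. *)
Lemma belief_chain Ls A E E' : A \subset E' -> E' \subset E ->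
  \sum_(o in A) belief Ls E o = (\sum_(o in A) belief Ls E' o) * \sum_(o in E') belief Ls E o.
Proof.
move=> AE' E'E; rewrite !sum_belief.
have [e|ne] := eqVneq (E' :&: top Ls E) set0.
  suff -> : A :&: top Ls E = set0 by rewrite e !big_set0 !mul0r mulr0.
  by apply/eqP; rewrite -subset0 -e setSI.
rewrite (top_subset E'E ne) setIA (setIidPl AE') mulrA divfK //.
by rewrite gt_eqF // sum_weight_gt0.
Qed.

Lemma expectation_belief Ls E (f : T -> F) :
  \sum_o f o * belief Ls E o = (\sum_(o in top Ls E) f o * w o) / \sum_(o in top Ls E) w o.
Proof.
rewrite mulr_suml [RHS]big_mkcond; apply: eq_bigr => o _; rewrite /belief.
by case: ifP; rewrite ?mulr0 ?mulrA.
Qed.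

End Layers.

(** * The estimate for weighted payoffs *)

Local Open Scope ring_scope.

(* The right-hand side is [- #|Q|]; on the left all terms are nonpositive, and one
   with [b o < a o] is at most [- M]. *)
Lemma sum_extreme_le (F : realFieldType) (T : finType) (Q : {set T}) (M : nat) (a b : T -> nat) :
  (0 < M)%N -> (#|Q| <= M)%N ->
  (forall o, o \in Q -> a o = b o) \/ (exists2 o, o \in Q & (b o < a o)%N) ->
  \sum_(o in Q) - (M%:R ^- b o) * M%:R ^+ a o
    <= \sum_(o in Q) - (M%:R ^- a o) * M%:R ^+ a o :> F.
Proof.
move=> M0 QM; have M1 : 0 < M%:R :> F by rewrite ltr0n.
case=> [e|[o oQ lt]].
  by rewrite le_eqVlt; apply/orP; left; apply/eqP/eq_bigr => o oQ; rewrite e.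
rewrite [leRHS](eq_bigr (fun=> -1)) => [|o' _]; last first.
  by rewrite mulNr mulVf // expf_neq0 // gt_eqF.
rewrite sumr_const (big_setD1 o) //= -[leRHS]addr0; apply: lerD; last first.
  apply: sumr_le0 => o' _; rewrite mulNr oppr_le0 mulr_ge0 ?invr_ge0 ?exprn_ge0 ?ltW //.
rewrite mulNr mulNrn lerN2.
(* As [b o < a o], the exponent left after cancellation is a successor, so a factor [M] can be split
   off. *)
have -> : a o = (b o + (a o - b o).-1.+1)%N by rewrite prednK ?subn_gt0 // subnKC // ltnW.
rewrite exprD mulrA mulVf ?expf_neq0 ?gt_eqF // mul1r exprS.
apply: le_trans (_ : M%:R <= _); first by rewrite ler_nat.
by rewrite ler_peMr ?(ltW M1) // exprn_ege1 ?ler1n.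
Qed.

(** * Sequential rationality and conditional B-dominance *)

Section Rationality.
Context {I Act Info : finType} {g : game I Act Info} {i : I}.
Hypothesis wfg : wf_game g.
Implicit Types (z : Hist I Act) (h k : Info) (s t : Strat g i) (o : Opp g i)
  (Q : {set Opp g i}).

(** An ordinal utility with natural values: on terminal histories it represents the preference, and
    it serves as an exponent of [M]. *)
Definition rank z := count [pred z' | terminal g z' && pref g i z z'] (hists g).

Lemma pref_trans z1 z2 z3 : terminal g z1 -> terminal g z2 -> terminal g z3 ->
  pref g i z1 z2 -> pref g i z2 z3 -> pref g i z1 z3.
Proof. by case: wfg => _ _ _ _ /(_ i)[_]; apply. Qed.

Lemma pref_rank z z' : terminal g z -> terminal g z' -> pref g i z z' -> (rank z' <= rank z)%N.
Proof.
move=> tz tz' zz'; apply: sub_count => y /= /andP[ty z'y]; rewrite ty.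
exact: pref_trans zz' z'y.
Qed.

Lemma strict_pref_rank z z' :
  terminal g z -> terminal g z' -> strict_pref g i z z' -> (rank z' < rank z)%N.
Proof.
move=> tz tz' /andP[zz' nz'z]; apply: (@ltn_count _ _ _ _ z) => /=.
- by move=> y /= /andP[ty z'y]; rewrite ty; apply: pref_trans zz' z'y.
- by case/andP: tz.
- by rewrite tz pref_refl.
- by rewrite tz.
Qed.

(** Tested on the support [Q] of the belief at [h], B-dominance yields a [t] that is never worse on
    [Q] and strictly better at a point of positive mass, which contradicts the optimality of [s]. *)
Lemma seqrat_not_condBdom s : seqrat s -> ~ condBdom (fullR g) s.
Proof.
case=> u [mu [repr [cps _] opt]] /condBdom_full[h [ih hs [_ dom]]].
have ch : condev (SoH g i h) by apply/existsP; exists h; rewrite ih eqxx.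
have [mu0 mu1 muE] := cps _ ch; set m := mu (SoH g i h) in mu0 mu1 muE.
pose Q := [set o in SoH g i h | m o != 0].
have Q0 : Q != set0.
  apply: contraTneq (oner_neq0 R) => Q0; rewrite -muE negbK; apply/eqP/big1 => o ho.
  by apply/eqP; apply: contraT => mo; have := in_set0 o; rewrite -Q0 inE ho mo.
have QS : Q \subset SoH g i h by apply/subsetP=> o; rewrite inE => /andP[].
(* [SoH g i h] carries the full mass 1, so the nonnegative masses outside it sum to 0. *)
have out o : o \notin Q -> m o = 0.
  rewrite inE negb_and negbK => /orP[ho|/eqP//].
  move: mu1; rewrite /mass (big_setID (SoH g i h)) /= setTI -/(mass m _) muE.
  move/eqP; rewrite -subr_eq0 addrAC subrr add0r psumr_eq0 // => /allP/(_ o).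
  by rewrite mem_index_enum in_setD ho in_setT => /(_ isT)/eqP.
have [t [_ ht pre [o1 Qo1 str]]] := dom Q Q0 QS.
have := opt h ih hs t ht; rewrite leNgt => /negP[]; rewrite -/m -subr_gt0 -sumrB.
have le o : 0 <= u (zeta t o) * m o - u (zeta s o) * m o.
  have [Qo|/out->] := boolP (o \in Q); last by rewrite !mulr0 subrr.
  rewrite -mulrBl mulr_ge0 // subr_ge0.
  by apply/(repr _ _ (zeta_terminal wfg t o) (zeta_terminal wfg s o)); apply: pre.
rewrite (bigD1 o1) //=; apply: ltr_wpDr; first exact: sumr_ge0.
rewrite -mulrBl mulr_gt0 //; last by rewrite lt0r mu0 andbT; case/setIdP: Qo1.
rewrite subr_gt0 ltNge; apply/negP.
case/andP: str => _ /negP str; apply: contra_not str => le'.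
by apply/(repr _ _ (zeta_terminal wfg s o1) (zeta_terminal wfg t o1)).
Qed.

Lemma not_condBdom_seqrat s : ~ condBdom (fullR g) s -> seqrat s.
Proof.
(* [M] bounds the size of every [Q], as [sum_extreme_le] requires; adding 2 also gives [1 < M], so
   that powers of [M] are strictly increasing. *)
move=> nB; pose M := #|{: Opp g i}|.+2.
have M1 : 1 < M%:R :> R by rewrite ltr1n.
have M0 : 0 < M%:R :> R by rewrite ltr0n.
pose u z : R := - (M%:R ^- rank z).
pose w o : R := M%:R ^+ rank (zeta s o).
have w0 o : 0 < w o by rewrite exprn_gt0.
pose good h Q := [&& Q != set0, Q \subset SoH g i h & undominated h Q s].
pose Qh h := odflt set0 [pick Q | good h Q].
have QhP h : isInfo g i h -> s \in SiH g i h -> good h (Qh h).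
  move=> ih hs; rewrite /Qh; case: pickP => // none.
  by have [Q] := condBdomPn nB ih hs; rewrite -/(good h Q) none.
pose depth : Info -> nat := dep (g := g) (i := i).
pose hs := [seq h <- enum Info | isInfo g i h && (s \in SiH g i h)].
pose Ls := map Qh (sort (relpre depth leq) hs).
have E0 (E : {set Opp g i}) : condev E -> E != set0.
  case/existsP=> h /andP[ih /eqP->]; apply: (SoH_neq0 wfg _ ih); exact: (val s h).
exists u, (belief w Ls); split.
- move=> z z' tz tz'; rewrite lerN2 lef_pV2 ?posrE ?exprn_gt0 // ler_eXn2l //.
  split; last exact: pref_rank.
  apply: contraLR => /(prefNge wfg tz tz')/(strict_pref_rank tz' tz).
  by rewrite -ltnNge.
- split=> [E /E0 En|A E E' _ _ AE' E'E]; last exact: belief_chain.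
  by split; [exact: belief_ge0|apply: sum_belief1 | apply: sum_belief1].
- move=> h ih sh t th; rewrite !expectation_belief.
  rewrite ler_wpM2r // ?invr_ge0 ?sumr_ge0 // => [o _|]; first exact: ltW.
  have [Q0 QS und] := and3P (QhP h ih sh).
  have : exists k, [/\ k \in sort (relpre depth leq) hs, (depth k <= depth h)%N,
      SoH g i h :&: Qh k != set0 & top Ls (SoH g i h) = SoH g i h :&: Qh k].
    apply: top_sorted.
    - by apply: sort_sorted => ? ?; apply: leq_total.
    - by rewrite mem_sort mem_filter ih sh mem_enum.
    - by rewrite (setIidPr QS).
  case=> k []; rewrite mem_sort mem_filter => /andP[/andP[ik sk] _] dk ne ->.
  have [_ QSk undk] := and3P (QhP k ik sk).
  (* With [s], a profile [o] in the support reaches both [k] and [h], which puts them on one play,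
     [k] no later than [h]. *)
  have [o /setIP[ho Qo]] := set0Pn _ ne.
  have rk := SiH_SoH wfg sk (subsetP QSk _ Qo).
  have rh := SiH_SoH wfg sh ho.
  have und' := undominated_later wfg sh (reaches_earlier wfg rk rh dk) undk.
  apply: sum_extreme_le => //; first by rewrite leqW // leqW // max_card.
  have /forallP/(_ t) := und'; rewrite th /= negb_and.
  set Q := _ :&: _.
  (* If [s] is strictly better somewhere on [Q], then [t] has a large loss there. Otherwise [t] is
     nowhere worse, and as it does not dominate [s] it is nowhere better, so all ranks agree. *)
  have [/existsP[o' /andP[Qo' str]] _|/existsPn no] :=
      boolP [exists o in Q, strict_pref g i (zeta s o) (zeta t o)].
    right; exists o' => //.
    exact: (strict_pref_rank (zeta_terminal wfg _ _) (zeta_terminal wfg _ _) str).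
  have pre o' : o' \in Q -> pref g i (zeta t o') (zeta s o').
    move=> Qo'; have := no o'; rewrite Qo' /=; apply: contraNT.
    exact: (prefNge wfg (zeta_terminal wfg _ _) (zeta_terminal wfg _ _)).
  case/orP=> [/negP[]|/existsPn no'].
    by apply/forallP=> o'; apply/implyP; apply: pre.
  left=> o' Qo'; apply/eqP; rewrite eqn_leq; apply/andP; split.
    exact: pref_rank (zeta_terminal wfg _ _) (zeta_terminal wfg _ _) (pre _ Qo').
  apply: pref_rank (zeta_terminal wfg _ _) (zeta_terminal wfg _ _) _.
  have := no' o'; rewrite Qo' /= /strict_pref pre //= negbK //.
Qed.

End Rationality.

Theorem theorem1 (I Act Info : finType) (g : game I Act Info) (i : I) (s : Strat g i) :
  wf_game g -> (seqrat s <-> ~ condBdom (fullR g) s).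
Proof.
by move=> wfg; split; [apply: seqrat_not_condBdom | apply: not_condBdom_seqrat].
Qed.
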